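(* Let $B_4$ be the fourth weak Bruhat graph. Then $\pi(B_4)\le 66$.
   Context: The fourth weak Bruhat graph $B_4$ is the graph whose $24$ vertices are the permutations of $\{1,2,3,4\}$ (the elements of the symmetric group $S_4$), in which two permutations are adjacent exactly when one covers the other in the weak Bruhat order, i.e. when one is obtained from the other by swapping two adjacent entries (composing with an adjacent transposition $(i\ i{+}1)$, $i\in\{1,2,3\}$); equivalently, the Cayley graph of $S_4$ with generators $(1\,2),(2\,3),(3\,4)$. A configuration on a graph $G$ is a function $C:V(G)\to\mathbb{N}$, with size $|C|=\sum_v C(v)$. A pebbling move along an edge $uv$ is allowed when $C(u)\ge 2$; it removes two pebbles from $u$ and adds one pebble to $v$. For a root vertex $r$, $C$ is $r$-solvable if some sequence of pebbling moves yields at least one pebble on $r$. $\pi(G,r)$ is the smallest $t$ such that every configuration of size $t$ is $r$-solvable, and the pebbling number is $\pi(G)=\max_{r\in V(G)}\pi(G,r)$. *)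

(* Defs.v *)
From mathcomp Require Import all_boot all_fingroup.

Set Implicit Arguments.
Unset Strict Implicit.
Unset Printing Implicit Defensive.

(* [p : 'S_n] is read in one-line notation p(0) p(1) ... p(n-1). As
   (s * p)%g x = p (s x), the product [tperm i j * p] swaps the entries of [p]
   in positions [i] and [j]. *)
Definition weak_bruhat (n : nat) : rel 'S_n := fun p q =>
  [exists i : 'I_n, exists j : 'I_n,
    (j == i.+1 :> nat) && (q == (tperm i j * p)%g)].

Definition B4 : rel 'S_4 := @weak_bruhat 4.

Section Pebbling.
Variables (V : finType) (e : rel V).

Definition config := {ffun V -> nat}.

Definition config_size (C : config) : nat := \sum_v C v.

Definition move (C : config) (u v : V) : config :=
  [ffun w => C w - 2 * (w == u) + (w == v)].

Definition pebbling_step : rel config := fun C D =>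
  [exists u, exists v, [&& e u v, 2 <= C u & D == move C u v]].

Definition root_solvable (r : V) (C : config) : Prop :=
  exists2 s : seq config, path pebbling_step C s & 0 < last C s r.

Definition every_config_solvable (r : V) (t : nat) : Prop :=
  forall C : config, config_size C = t -> root_solvable r C.

(* The numbers pi(G, r) and pi(G) exist only for connected graphs, so they are
   given by their graphs: [is_pebbling_number k] means "pi(G) exists and equals
   k". *)
Definition is_rooted_pebbling_number (r : V) (t : nat) : Prop :=
  every_config_solvable r t /\ forall t', every_config_solvable r t' -> t <= t'.

Definition is_pebbling_number (k : nat) : Prop :=
  exists2 f : V -> nat,
    forall r, is_rooted_pebbling_number r (f r) & k = \max_r f r.

Lemma is_rooted_pebbling_number_unique r t t' :
  is_rooted_pebbling_number r t -> is_rooted_pebbling_number r t' -> t = t'.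
Proof.
by move=> [St mint] [St' mint']; apply/eqP; rewrite eqn_leq mint // mint'.
Qed.

Lemma is_pebbling_number_unique k k' :
  is_pebbling_number k -> is_pebbling_number k' -> k = k'.
Proof.
move=> [f fP ->] [g gP ->]; apply: eq_bigr => r _.
exact: is_rooted_pebbling_number_unique (fP r) (gP r).
Qed.

End Pebbling.

Lemma weak_bruhat_sym n : symmetric (@weak_bruhat n).
Proof.
suff imp p q : @weak_bruhat n p q -> weak_bruhat q p.
  by move=> p q; apply/idP/idP; apply: imp.
case/existsP=> i /existsP[j /andP[ij /eqP->]].
apply/existsP; exists i; apply/existsP; exists j.
by rewrite ij /= mulgA tperm2 mul1g.
Qed.

Lemma weak_bruhat_irr n : irreflexive (@weak_bruhat n).
Proof.
move=> p; apply/negbTE/negP.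
move=> /existsP[i /existsP[j /andP[/eqP ij /eqP pE]]].
have /permP/(_ i) : tperm i j = 1%g by apply: (mulIg p); rewrite mul1g -pE.
rewrite tpermL perm1 => ji; move: ij; rewrite ji => /eqP.
by rewrite ltn_eqF.
Qed.

(* Main.v *)
Require Import Defs.
From mathcomp Require Import all_boot all_fingroup boolp.

Set Implicit Arguments.
Unset Strict Implicit.
Unset Printing Implicit Defensive.

(** Hurlbert's weight function method. Let [w] be a weight on the vertices such
    that every vertex [v] of positive weight is adjacent to the root or to a
    vertex of weight at least [2 * w v]. Moving two pebbles from [v] to that
    neighbour does not lower the total weight of the configuration, and this is
    possible as long as some vertex of positive weight holds two pebbles. So a
    configuration that weighs more than the all-ones configuration reaches the
    root. Such a weight is obtained by halving along a walk from the root, and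
    the pointwise maximum of two of them is another.

    In [B4], take eight geodesics from the root to its antipode, at distance 6,
    weighted 32, 16, 8, 4, 2, 1. The antipode gets 8, but at distances 4 and 5
    some vertices get less; side branches of one or two vertices at four of the
    geodesics repair this. The eight weights then sum to at least 8 at each
    vertex other than the root and to 520 = 8 * 65 in total: hence any 66
    pebbles outweigh the all-ones configuration for one of them. *)

Section Solvability.
Variables (V : finType) (e : rel V).
Implicit Types (C : config V) (r : V).

Lemma root_solvable_pebbled r C : 0 < C r -> root_solvable e r C.
Proof. by move=> Cr; exists [::]. Qed.

Lemma root_solvable_move r C u v :
  e u v -> 2 <= C u -> root_solvable e r (move C u v) -> root_solvable e r C.
Proof.
move=> euv Cu [s ps lsr]; exists (move C u v :: s) => //=.
rewrite ps andbT; apply/existsP; exists u; apply/existsP; exists v.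
by rewrite euv Cu /=.
Qed.

Lemma rooted_pebbling_number_le r t :
  every_config_solvable e r t ->
  exists2 k, is_rooted_pebbling_number e r k & k <= t.
Proof.
move=> /asboolT solv_t.
have ex_solv : exists k, `[< every_config_solvable e r k >] by exists t.
have [k /asboolP solv_k min_k] := ex_minnP ex_solv.
by exists k; [split=> // t' /asboolT | ]; apply: min_k.
Qed.

Lemma pebbling_number_le t :
  (forall r, every_config_solvable e r t) ->
  exists2 k, is_pebbling_number e k & k <= t.
Proof.
move=> solv_t.
have [f fP f_le] :=
  fin_all_exists2 (fun r => rooted_pebbling_number_le (solv_t r)).
by exists (\max_r f r); [exists f | apply/bigmax_leqP => r _].
Qed.

End Solvability.

Section Homomorphism.
Variables (V V' : finType) (e : rel V) (e' : rel V') (f : V -> V').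
Hypothesis f_homo : {homo f : u v / e u v >-> e' u v}.

Lemma root_solvable_homo r (C : config V') :
  injective f -> root_solvable e r [ffun v => C (f v)] ->
  root_solvable e' (f r) C.
Proof.
move=> f_inj [s]; elim: s C => [|D s IHs] C /=.
  by rewrite ffunE => _; apply: root_solvable_pebbled.
case/andP=> /existsP[u /existsP[v /and3P[euv Cu /eqP->]]] ps ls.
rewrite ffunE in Cu; apply: (root_solvable_move (f_homo euv) Cu).
suff CE : move [ffun v => C (f v)] u v = [ffun x => move C (f u) (f v) (f x)].
  by apply: IHs; rewrite -CE.
by apply/ffunP => x; rewrite !ffunE !(inj_eq f_inj).
Qed.

Lemma every_config_solvable_homo r t :
  bijective f -> every_config_solvable e r t ->
  every_config_solvable e' (f r) t.
Proof.
move=> f_bij solv_t C sizeC; apply: (root_solvable_homo (bij_inj f_bij)).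
apply: solv_t; rewrite -sizeC /config_size (reindex f) /=; last exact: onW_bij.
by apply: eq_bigr => v _; rewrite ffunE.
Qed.

End Homomorphism.

Section WeightStrategies.
Variables (V : finType) (e : rel V) (r : V).
Implicit Types (C : config V) (w : V -> nat).

Definition weight w C : nat := \sum_v C v * w v.

Definition weight_strategy w : Prop :=
  forall v, 0 < w v -> exists2 u, e v u & (u == r) || (2 * w v <= w u).

Lemma weight1 C : weight (fun=> 1) C = config_size C.
Proof. by apply: eq_bigr => v _; rewrite muln1. Qed.

Lemma weight_move w C u v :
  2 <= C u -> weight w (move C u v) + 2 * w u = weight w C + w v.
Proof.
have sum_at x : w x = \sum_y (y == x) * w y.
  by under eq_bigr do rewrite mulnbl; rewrite -big_mkcond big_pred1_eq.
move=> Cu; rewrite (sum_at u) (sum_at v) big_distrr -!big_split /=.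
apply: eq_bigr => x _; rewrite ffunE.
case: (altP (x =P u)) => [->|_] /=; last by rewrite muln0 subn0 mulnDl addn0.
by rewrite mul1n muln1 -!mulnDl addnAC subnK.
Qed.

Lemma config_size_move C u v :
  2 <= C u -> config_size C = (config_size (move C u v)).+1.
Proof.
move/(weight_move (fun=> 1) v); rewrite !weight1 muln1 addn2 addn1.
by case=> ->.
Qed.

Lemma weight_strategy_solvable w C :
  weight_strategy w -> \sum_v w v < weight w C -> root_solvable e r C.
Proof.
move=> w_strat; have [n] := ubnP (config_size C).
elim: n C => // n IHn C sizeC heavyC.
have /existsP[v /andP[wv Cv]] : [exists v, (0 < w v) && (1 < C v)].
  apply: contraTT heavyC => /existsPn flatC.
  rewrite -leqNgt; apply: leq_sum => v _; have := flatC v.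
  rewrite negb_and -eqn0Ngt -leqNgt => /orP[/eqP->|Cv]; first by rewrite muln0.
  by rewrite -[X in _ <= X]mul1n leq_mul.
have [u evu u_root_or_heavy] := w_strat v wv.
apply: (root_solvable_move evu Cv).
case/orP: u_root_or_heavy => [/eqP->|wu].
  by apply: root_solvable_pebbled; rewrite ffunE eqxx addn1.
apply: IHn; first by rewrite -ltnS -(config_size_move _ Cv).
apply: leq_trans heavyC _.
by rewrite -(leq_add2r (2 * w v)) (weight_move w u Cv) leq_add2l.
Qed.

Lemma weight_strategy_maxn w1 w2 :
  weight_strategy w1 -> weight_strategy w2 ->
  weight_strategy (fun v => maxn (w1 v) (w2 v)).
Proof.
move=> w1_strat w2_strat v.
case: (leqP (w1 v) (w2 v)) => _ => [/w2_strat|/w1_strat] [u evu u_step].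
  by exists u => //; rewrite leq_max orbCA u_step orbT.
by exists u => //; rewrite leq_max orbA u_step.
Qed.

Lemma weight_strategies_solvable (I : eqType) (l : seq I) (w : I -> V -> nat)
    m t :
  {in l, forall i, weight_strategy (w i)} ->
  (forall v, v != r -> m <= \sum_(i <- l) w i v) ->
  \sum_(i <- l) \sum_v w i v < m * t ->
  every_config_solvable e r t.
Proof.
move=> w_strat cover total C sizeC.
case: (posnP (C r)) => [Cr0|]; last exact: root_solvable_pebbled.
have heavyC : m * t <= \sum_(i <- l) weight (w i) C.
  rewrite exchange_big -sizeC big_distrr /=; apply: leq_sum => v _.
  rewrite -big_distrr mulnC leq_mul2l /=.
  by case: eqVneq (cover v) => [->|_ ->] //; rewrite ?Cr0 ?orbT.
have /hasP[i li] : has (fun i => \sum_v w i v < weight (w i) C) l.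
  apply: contraTT total => /hasPn light; rewrite -leqNgt.
  apply: leq_trans heavyC _; rewrite big_seq [X in _ <= X]big_seq.
  by apply: leq_sum => i /light; rewrite -leqNgt.
exact: weight_strategy_solvable (w_strat i li).
Qed.

End WeightStrategies.

Section TreeWeights.
Variable N : nat.

Definition path_weight (V : eqType) (s : seq V) (v : V) : nat :=
  if v \in s then N %/ 2 ^ index v s else 0.

Definition tree_weight (V : eqType) (T : seq (seq V)) (v : V) : nat :=
  \max_(s <- T) path_weight s v.

Lemma path_weight_strategy (V : finType) (e : rel V) r s :
  symmetric e -> path e r s -> weight_strategy e r (path_weight s).
Proof.
move=> e_sym r_path v; rewrite {1 2}/path_weight; case: ifP => // sv _.
have lt_vs : index v s < size s by rewrite index_mem.
exists (nth r (r :: s) (index v s)).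
  by rewrite e_sym -[X in e _ X](nth_index r sv); apply/(pathP r).
case: (index v s) lt_vs => [|i] /= lt_is; first by rewrite eqxx.
rewrite /path_weight mem_nth ?(ltnW lt_is) //; apply/orP; right.
apply: (@leq_trans (N %/ 2 ^ i)).
  by rewrite expnSr divnMA mulnC leq_trunc_div.
by rewrite leq_div2l ?expn_gt0 // leq_exp2l // index_nth // ltnW.
Qed.

Lemma tree_weight_strategy (V : finType) (e : rel V) r T :
  symmetric e -> {in T, forall s, path e r s} ->
  weight_strategy e r (tree_weight T).
Proof.
rewrite /tree_weight => e_sym; elim: T => [|s T IHT] pathT v.
  by rewrite big_nil.
have s_strat := path_weight_strategy e_sym (pathT s (mem_head s T)).
have T_strat : weight_strategy e r (fun v => \max_(s <- T) path_weight s v).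
  by apply: IHT => s' Ts'; apply: pathT; rewrite inE Ts' orbT.
rewrite big_cons => /(weight_strategy_maxn s_strat T_strat)[u evu].
by exists u; rewrite // big_cons.
Qed.

Lemma tree_weight_map (V V' : eqType) (f : V -> V') T v :
  injective f -> tree_weight (map (map f) T) (f v) = tree_weight T v.
Proof.
move=> f_inj; rewrite /tree_weight big_map; apply: eq_bigr => s _.
by rewrite /path_weight mem_map // index_map.
Qed.

End TreeWeights.

Lemma weak_bruhat_mulr n (r : 'S_n) :
  {homo mulg^~ r : p q / @weak_bruhat n p q}.
Proof.
move=> p q /existsP[i /existsP[j /andP[ij /eqP->]]].
by apply/existsP; exists i; apply/existsP; exists j; rewrite ij mulgA eqxx.
Qed.

Lemma weak_bruhat_solvable_from1 n (r : 'S_n) t :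
  every_config_solvable (@weak_bruhat n) 1%g t ->
  every_config_solvable (@weak_bruhat n) r t.
Proof.
move=> solv1; rewrite -[r]mul1g.
apply: (every_config_solvable_homo (@weak_bruhat_mulr n r) _ solv1).
by exists (mulg^~ r^-1%g); [apply: mulgK | apply: mulgKV].
Qed.

Section OneLine.
Variable n : nat.
Implicit Types (p q : 'S_n.+1) (s : seq nat) (k : nat).

(* Unlike permutations, their one-line words can be computed with. *)
Definition one_line p : seq nat := [seq val (p i) | i <- enum 'I_n.+1].

Lemma size_one_line p : size (one_line p) = n.+1.
Proof. by rewrite size_map size_enum_ord. Qed.

Lemma nth_one_line p (i : 'I_n.+1) : nth 0 (one_line p) i = p i.
Proof. by rewrite (nth_map i) ?size_enum_ord // nth_ord_enum. Qed.

Lemma one_line_inj : injective one_line.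
Proof.
move=> p q epq; apply/permP => i; apply: val_inj => /=.
by rewrite -!nth_one_line epq.
Qed.

Lemma one_line1 : one_line 1%g = iota 0 n.+1.
Proof. by rewrite -val_enum_ord; apply: eq_map => i; rewrite perm1. Qed.

Lemma one_line_permutations p : one_line p \in permutations (iota 0 n.+1).
Proof.
rewrite mem_permutations -val_enum_ord /one_line (map_comp val) perm_map //.
apply: uniq_perm; rewrite ?(map_inj_uniq perm_inj) ?enum_uniq //.
move=> i; rewrite mem_enum inE; apply/mapP; exists (p^-1%g i).
  by rewrite mem_enum.
by rewrite permKV.
Qed.

Lemma sum_one_line (F : seq nat -> nat) :
  \sum_p F (one_line p) = \sum_(s <- permutations (iota 0 n.+1)) F s.
Proof.
rewrite -(big_map one_line xpredT F); apply: perm_big.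
have uniq_one_line : uniq (map one_line (index_enum 'S_n.+1)).
  by rewrite map_inj_uniq ?index_enum_uniq //; apply: one_line_inj.
apply: uniq_perm => //; first exact: permutations_uniq.
apply: (uniq_min_size uniq_one_line _ _).2 => [_ /mapP[p _ ->]|].
  exact: one_line_permutations.
rewrite size_permutations ?iota_uniq // size_iota size_map.
by rewrite -card_Sn cardT enumT.
Qed.

Definition perm_swap p k : 'S_n.+1 := (tperm (inord k) (inord k.+1) * p)%g.

Definition seq_swap s k : seq nat :=
  set_nth 0 (set_nth 0 s k (nth 0 s k.+1)) k.+1 (nth 0 s k).

Lemma weak_bruhat_perm_swap p k : k < n -> weak_bruhat p (perm_swap p k).
Proof.
move=> lt_kn; apply/existsP; exists (inord k); apply/existsP.
by exists (inord k.+1); rewrite !inordK ?ltnS ?(ltnW lt_kn) ?eqxx.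
Qed.

Lemma one_line_perm_swap p k :
  k < n -> one_line (perm_swap p k) = seq_swap (one_line p) k.
Proof.
move=> lt_kn; have lt_kn1 := ltnW lt_kn.
apply: (@eq_from_nth _ 0) => [|x].
  by rewrite !size_set_nth !size_one_line !(maxn_idPr _).
rewrite size_one_line => lt_xn; rewrite (nth_one_line _ (Ordinal lt_xn)) permM.
rewrite !nth_set_nth /= nth_set_nth /=.
case: tpermP => [/(congr1 val)|/(congr1 val)|] /=.
- by rewrite inordK // => ->; rewrite ltn_eqF // eqxx -nth_one_line inordK.
- by rewrite inordK // => ->; rewrite eqxx -nth_one_line inordK.
move=> /eqP/negbTE x_k /eqP/negbTE x_k1.
move: x_k x_k1; rewrite -!val_eqE /= !inordK // => -> ->.
by rewrite -nth_one_line.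
Qed.

Definition perm_walk (word : seq nat) : seq 'S_n.+1 := scanl perm_swap 1%g word.

Definition seq_walk (word : seq nat) : seq (seq nat) :=
  scanl seq_swap (iota 0 n.+1) word.

Lemma path_perm_walk word :
  all (gtn n) word -> path (@weak_bruhat n.+1) 1%g (perm_walk word).
Proof.
rewrite /perm_walk; elim: word 1%g => //= k word IHword p /andP[lt_kn word_lt].
by rewrite weak_bruhat_perm_swap // IHword.
Qed.

Lemma map_one_line_perm_walk word :
  all (gtn n) word -> map one_line (perm_walk word) = seq_walk word.
Proof.
rewrite /perm_walk /seq_walk -one_line1.
elim: word 1%g => //= k word IHword p /andP[lt_kn word_lt].
by rewrite IHword // one_line_perm_swap.
Qed.

Lemma tree_weight_one_line N T p :
  all (all (gtn n)) T ->
  tree_weight N (map seq_walk T) (one_line p)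
    = tree_weight N (map perm_walk T) p.
Proof.
move=> /allP T_lt; rewrite -(tree_weight_map _ _ _ one_line_inj) -map_comp.
congr tree_weight; apply/eq_in_map => word /T_lt word_lt /=.
by rewrite map_one_line_perm_walk.
Qed.

Lemma weak_bruhat_trees_solvable (Ts : seq (seq (seq nat))) N m t
    (r : 'S_n.+1) :
  all (all (all (gtn n))) Ts ->
  all (fun s => (s == iota 0 n.+1)
          || (m <= \sum_(T <- Ts) tree_weight N (map seq_walk T) s))
      (permutations (iota 0 n.+1)) ->
  \sum_(T <- Ts) \sum_(s <- permutations (iota 0 n.+1))
    tree_weight N (map seq_walk T) s < m * t ->
  every_config_solvable (@weak_bruhat n.+1) r t.
Proof.
move=> /allP Ts_lt /allP cover total; apply: weak_bruhat_solvable_from1.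
have weightE T p : T \in Ts -> tree_weight N (map perm_walk T) p
    = tree_weight N (map seq_walk T) (one_line p).
  by move=> /Ts_lt /tree_weight_one_line.
apply: (@weight_strategies_solvable _ _ _ _ Ts
         (fun T => tree_weight N (map perm_walk T)) m).
- move=> T /Ts_lt /allP T_lt; apply: tree_weight_strategy.
    exact: weak_bruhat_sym.
  by move=> _ /mapP[word /T_lt word_lt ->]; apply: path_perm_walk.
- move=> p p_neq1; rewrite (eq_big_seq _ (fun T => @weightE T p)).
  have := cover _ (one_line_permutations p).
  by rewrite -one_line1 (inj_eq one_line_inj) (negbTE p_neq1).
apply: leq_ltn_trans total; rewrite big_seq [X in _ <= X]big_seq.
apply: leq_sum => T TTs; rewrite -sum_one_line.
by apply: leq_sum => p _; rewrite weightE.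
Qed.

End OneLine.

(* The first word of each tree spells a geodesic from the identity to its
   antipode; a second word ends in the side branch. *)
Definition half_B4_trees : seq (seq (seq nat)) :=
  [:: [:: [:: 0; 2; 1; 0; 2; 1]];
      [:: [:: 0; 1; 0; 2; 1; 0]];
      [:: [:: 1; 0; 2; 1; 0; 2]; [:: 1; 0; 2; 1; 2]];
      [:: [:: 2; 1; 0; 1; 2; 1]; [:: 2; 1; 0; 2; 1]]].

(* [subn 2] exchanges the generators 0 and 2: this is the symmetry of [B4] that
   conjugates by the order-reversing permutation. *)
Definition B4_trees : seq (seq (seq nat)) :=
  half_B4_trees ++ map (map (map (subn 2))) half_B4_trees.

Lemma B4_trees_cover :
  all (fun s => (s == iota 0 4)
          || (8 <= \sum_(T <- B4_trees) tree_weight 32 (map (seq_walk 3) T) s))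
      (permutations (iota 0 4)).
Proof. by rewrite /tree_weight unlock; vm_compute. Qed.

Lemma B4_trees_total :
  \sum_(T <- B4_trees) \sum_(s <- permutations (iota 0 4))
    tree_weight 32 (map (seq_walk 3) T) s = 520.
Proof. by rewrite /tree_weight unlock; vm_compute. Qed.

Theorem mainTheorem8 : exists2 k : nat, is_pebbling_number B4 k & k <= 66.
Proof.
apply: pebbling_number_le => r.
apply: (weak_bruhat_trees_solvable r _ B4_trees_cover) => //.
by rewrite B4_trees_total.
Qed.
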